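(* For a connected hypergraph $\mathbf{H}$ on $[n]$, the integer points enumerator $F_q(P_{\mathbf{H}})$ associated to the hypergraphic polytope $P_{\mathbf{H}}$ and the quasisymmetric function $\Psi_q([\mathbf{H}])$ coincide: $$F_q(P_{\mathbf{H}}) = \Psi_q([\mathbf{H}]).$$
   Context: A hypergraph $\mathbf{H}$ on the vertex set $[n]$ is a collection of nonempty subsets of $[n]$ (hyperedges) containing all singletons $\{i\}$, $i\in[n]$. It is connected if it cannot be written as a disjoint union $\mathbf{H}_1\sqcup\mathbf{H}_2$ of hypergraphs; $c(\mathbf{H})$ denotes the number of connected components, and for a hypergraph on $m$ vertices $\mathrm{rk}(\mathbf{H})=m-c(\mathbf{H})$. For $S\subseteq[n]$, the restriction is $\mathbf{H}|_S=\{H\in\mathbf{H}: H\subseteq S\}$ and the contraction is $\mathbf{H}/S=\{H\setminus S: H\in\mathbf{H}\}$. A flag is a chain $\mathcal{F}:\emptyset=F_0\subset F_1\subset\cdots\subset F_k=[n]$; its type is the composition $\mathrm{type}(\mathcal{F})=(|F_1|,|F_2\setminus F_1|,\ldots,|F_k\setminus F_{k-1}|)$ of $n$. The splitting hypergraph is $\mathbf{H}/\mathcal{F}=\bigsqcup_{i=1}^k \mathbf{H}|_{F_i}/F_{i-1}$, with $\mathrm{rk}(\mathbf{H}/\mathcal{F})=n-\sum_{i=1}^k c(\mathbf{H}|_{F_i}/F_{i-1})$. $M_\alpha$ denotes the monomial quasisymmetric function indexed by a composition $\alpha$. Define $$\Psi_q([\mathbf{H}])=\sum_{\mathcal{F}}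 q^{\mathrm{rk}(\mathbf{H}/\mathcal{F})}M_{\mathrm{type}(\mathcal{F})},$$ the sum over all flags of $[n]$; this is the unique morphism of combinatorial Hopf algebras to quasisymmetric functions from the Hopf algebra of hypergraph isomorphism classes (product $[\mathbf{H}_1]\cdot[\mathbf{H}_2]=[\mathbf{H}_1\sqcup\mathbf{H}_2]$, coproduct $\Delta([\mathbf{H}])=\sum_{S\subseteq[n]}[\mathbf{H}|_S]\otimes[\mathbf{H}/S]$) with character $\zeta_q([\mathbf{H}])=q^{\mathrm{rk}(\mathbf{H})}$. The hypergraphic polytope is the Minkowski sum $P_{\mathbf{H}}=\sum_{H\in\mathbf{H}}\Delta_H$, where $\Delta_H=\mathrm{conv}\{e_i: i\in H\}$; it is a generalized permutohedron, i.e. its normal fan coarsens the braid arrangement fan (normal fan of the standard permutohedron $Pe^{n-1}$). Faces of $Pe^{n-1}$ correspond to flags $\mathcal{F}$; the relative interior $C^\circ_{\mathcal{F}}$ of the normal cone at $\mathcal{F}$ consists of $\omega$ whose coordinates are constant on each $F_i\setminus F_{i-1}$ and strictly increase with $i$. For a generalized permutohedron $Q$, $\pi_Q(\mathcal{F})=G$ iff $C^\circ_{\mathcal{F}}\subseteq C^\circ_G$ for the face $G$ of $Q$. With $M_{\mathcal{F}}=\sum_{\omega\in\mathbb{Z}^n_+\cap C^\circ_{\mathcal{F}}}x_{\omega_1}\cdots x_{\omega_n}=M_{\mathrm{type}(\mathcal{F})}$, the weighted integer points enumerator is $$F_q(Q)=\sum_{\omega\in\mathbb{Z}^n_+}q^{\dim(\pi_Q(\mathcal{F}_\omega))}x_{\omega_1}\cdots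 x_{\omega_n}=\sum_{\mathcal{F}}q^{\dim(\pi_Q(\mathcal{F}))}M_{\mathcal{F}},$$ where $\mathcal{F}_\omega$ is the unique face of $Pe^{n-1}$ whose normal cone contains $\omega$ in its relative interior. *)

(* Defs.v *)
From HB Require Import structures.
From mathcomp Require Import all_boot all_order all_algebra.
From mathcomp.multinomials Require Import monalg.

Set Implicit Arguments.
Unset Strict Implicit.
Unset Printing Implicit Defensive.

(* Hypergraphs live on a vertex set V inside a fixed ambient finType T, so that
   restrictions and contractions need no change of ambient type. *)
Section Hypergraphs.
Variable T : finType.
Implicit Types (V S : {set T}) (H : {set {set T}}) (F : seq {set T}).

Definition hypergraph V H : bool :=
  [forall E in H, (E != set0) && (E \subset V)]
  && [forall x in V, [set x] \in H].

Definition disjoint_union V H V1 H1 V2 H2 : bool :=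
  [&& V == V1 :|: V2, [disjoint V1 & V2], hypergraph V1 H1, hypergraph V2 H2
    & H == H1 :|: H2].

Definition hconnected V H : bool :=
  ~~ [exists V1 : {set T}, exists H1 : {set {set T}},
      exists V2 : {set T}, exists H2 : {set {set T}},
        [&& V1 != set0, V2 != set0 & disjoint_union V H V1 H1 V2 H2]].

Definition hrestrict H S : {set {set T}} := [set E in H | E \subset S].

(* Hyperedges contained in S would contract to the empty set; hyperedges being
   nonempty, they are dropped.  H / S is a hypergraph on V \ S. *)
Definition hcontract H S : {set {set T}} := [set E :\: S | E in H] :\ set0.

Definition hcomponent V H S : bool :=
  [&& S != set0, S \subset V,
      disjoint_union V H S (hrestrict H S) (V :\: S) (hrestrict H (V :\: S))
    & hconnected S (hrestrict H S)].

Definition ncomponents V H : nat := #|[set S | hcomponent V H S]|.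

Definition hrank V H : nat := #|V| - ncomponents V H.

(* The flag set0 = F_0 < F_1 < ... < F_k = [set: T] is the sequence
   [:: F_1; ...; F_k]. *)
Definition is_flag F : bool :=
  path (fun A B : {set T} => A \proper B) set0 F && (last set0 F == [set: T]).

Definition flag_blocks F : seq {set T} :=
  pairmap (fun A B : {set T} => B :\: A) set0 F.

Definition flag_block F (a : nat) : {set T} := nth set0 (flag_blocks F) a.

Definition flag_type F : seq nat := [seq #|B| | B : {set T} <- flag_blocks F].

Definition splitting H F : {set {set T}} :=
  \bigcup_(G <- pairmap (fun A B => hcontract (hrestrict H B) A) set0 F) G.

Definition splitting_rank H F : nat := hrank [set: T] (splitting H F).

End Hypergraphs.

From mathcomp Require Import all_classical reals topology normedtype.

Import Order.TTheory GRing.Theory Num.Theory.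
Import numFieldNormedType.Exports.

Local Open Scope classical_set_scope.
Local Open Scope ring_scope.

Section Polytopes.
Variables (R : realType) (n : nat).
Local Notation vec := 'rV[R]_n.
Implicit Types (A Q G : set vec) (w x y : vec).

Definition dotv w x : R := \sum_(i < n) w 0 i * x 0 i.

Definition affine_hull A : set vec :=
  [set x | exists k (a : 'I_k -> R) (p : 'I_k -> vec),
     [/\ forall i, A (p i), \sum_(i < k) a i = 1
       & x = \sum_(i < k) a i *: p i]].

Definition convex_hull A : set vec :=
  [set x | exists k (a : 'I_k -> R) (p : 'I_k -> vec),
     [/\ forall i, A (p i), forall i, 0 <= a i, \sum_(i < k) a i = 1
       & x = \sum_(i < k) a i *: p i]].

Definition relative_interior A : set vec :=
  [set x | A x /\ \forall y \near x, affine_hull A y -> A y].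

(* Dimension of the affine hull of A (0 when A is empty). *)
Definition affine_dim A : nat :=
  xget 0%N [set d | exists (a : vec) (U : {vspace vec}),
    affine_hull A = [set x | x - a \in U] /\ \dim U = d].

Definition max_face Q w : set vec :=
  [set x | Q x /\ forall y, Q y -> dotv w y <= dotv w x].

Definition is_face Q G : Prop := exists w, G = max_face Q w.

Definition normal_cone Q G : set vec := [set w | G `<=` max_face Q w].

(* Relative interior of the normal cone of the permutohedron at the face
   indexed by the flag F. *)
Definition braid_cone (F : seq {set 'I_n}) : set vec :=
  [set w | forall a b i j, i \in flag_block F a -> j \in flag_block F b ->
     (a = b -> w 0 i = w 0 j) /\ ((a < b)%N -> w 0 i < w 0 j)].

(* pi_Q(F) *)
Definition face_of_flag Q (F : seq {set 'I_n}) : set vec :=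
  xget set0 [set G | is_face Q G /\
                     braid_cone F `<=` relative_interior (normal_cone Q G)].

(* F_w *)
Definition flag_of_point w : seq {set 'I_n} :=
  xget [::] [set F | is_flag F /\ braid_cone F w].

Definition simplex (E : {set 'I_n}) : set vec :=
  convex_hull [set delta_mx 0 i | i in [set` E]].

Definition hypergraphic_polytope (H : {set {set 'I_n}}) : set vec :=
  [set x | exists p : {set 'I_n} -> vec,
     (forall E, E \in H -> simplex E (p E)) /\ x = \sum_(E in H) p E].

End Polytopes.

Arguments simplex R {n} E.
Arguments hypergraphic_polytope R {n} H.

(* Formal power series in the variables x_i, i : nat, given by their
   coefficients on the monomials; x_0 is never used. *)
Definition mseries (K : Type) := {cmonom nat} -> K.

Section Quasisymmetric.
Variable K : comNzRingType.

(* The formal sum of the c i * x^(mon i) for i in D; meaningful when each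
   monomial is x^(mon i) for only finitely many i in D. *)
Definition formal_sum (I : choiceType) (D : set I) (c : I -> K)
    (mon : I -> {cmonom nat}) : mseries K :=
  fun m => \sum_(i \in D `&` [set i | mon i = m]) c i.

(* x_(s_1)^(al_1) * ... * x_(s_k)^(al_k) *)
Definition monomial_at (al s : seq nat) : {cmonom nat} :=
  \big[mmul/mone]_(p <- zip s al) expcmn (ucm p.1) p.2.

(* Monomial quasisymmetric function; al is a composition (positive parts). *)
Definition monomial_qsym (al : seq nat) : mseries K :=
  formal_sum [set s : seq nat |
                [/\ size s = size al, sorted ltn s & all (leq 1) s]]
             (fun=> 1) (monomial_at al).

(* Sum over all flags; being strict, a flag has length k <= n. *)
Definition Psi (q : K) (n : nat) (H : {set {set 'I_n}}) : mseries K :=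
  fun m => \sum_(k < n.+1) \sum_(F : k.-tuple {set 'I_n} | is_flag F)
    q ^+ splitting_rank H F * monomial_qsym (flag_type F) m.

Definition points_enumerator (q : K) (R : realType) (n : nat)
    (Q : set 'rV[R]_n) : mseries K :=
  formal_sum [set w : {ffun 'I_n -> nat} | forall i, (0 < w i)%N]
    (fun w => q ^+ affine_dim
                (face_of_flag Q (flag_of_point (\row_i (w i)%:R : 'rV[R]_n))))
    (fun w => \big[mmul/mone]_(i < n) ucm (w i)).

End Quasisymmetric.

(* Main.v *)
Require Import Defs.
From mathcomp Require Import all_boot all_order all_algebra.

(** For a direction w, the face of P_H maximizing w is the Minkowski sum of the
    simplices on the sets M_E of maximizers of w on the hyperedges E.  Its
    affine hull is a translate of the span of the e_i - e_j with i, j in a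
    common M_E, and by the usual rank computation for graphs this span has
    dimension n minus the number of connected components of {M_E | E in H}.
    When w lies in the braid cone of the flag F, the hypergraph {M_E | E in H}
    is the splitting hypergraph H/F, so dim pi(F) = rk(H/F).  Finally, a point
    w with positive integer coordinates is the same as its flag F together with
    the increasing sequence of values of w on the blocks of F, and the values
    range over the index set of the monomials of M_type(F). *)

Set Implicit Arguments.
Unset Strict Implicit.
Unset Printing Implicit Defensive.
Import Order.TTheory GRing.Theory Num.Theory.

(** * Connected components *)

Section Components.
Variable T : finType.
Implicit Types (V S : {set T}) (H : {set {set T}}).

(** Two vertices are adjacent when a common hyperedge contains them. The components of the
    hypergraph are the classes of this graph, so canonical representatives can count them. *)
Definition share_edge H : rel T :=
  fun x y => [exists E in H, (x \in E) && (y \in E)].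

Lemma share_edge_sym H : symmetric (share_edge H).
Proof. by move=> x y; apply: eq_existsb => E; rewrite (andbC (x \in E)). Qed.

Lemma share_edge_connect_sym H : connect_sym (share_edge H).
Proof. exact/sym_connect_sym/share_edge_sym. Qed.

Lemma connect_class_edge H x E :
  E \in H -> (E \subset [set y | connect (share_edge H) x y])
             || (E \subset ~: [set y | connect (share_edge H) x y]).
Proof.
move=> EH; set C := [set y | _].
have [/exists_inP[z zE zC]|] := boolP [exists z in E, z \in C].
  apply/orP; left; apply/subsetP=> y yE; rewrite inE in zC; rewrite inE.
  apply: connect_trans zC (connect1 _); apply/exists_inP; exists E => //.
  by rewrite zE yE.
move/exists_inPn=> nE; apply/orP; right; apply/subsetP => y /nE.
by rewrite [y \in ~: C]inE.
Qed.

Lemma hypergraph_restrict H S :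
  hypergraph [set: T] H -> hypergraph S (hrestrict H S).
Proof.
move=> /andP[/forall_inP hH /forall_inP sH]; apply/andP; split; last first.
  by apply/forall_inP=> x xS; rewrite inE sub1set xS sH ?inE.
by apply/forall_inP=> E; rewrite inE => /andP[/hH/andP[-> _] ->].
Qed.

(** No edge crosses the boundary of a component, so a component contains the class of each of its
    points, and connectedness forces equality. Conversely, a splitting of a class would separate two
    vertices joined by a path. *)
Lemma hcomponent_class H S : hypergraph [set: T] H ->
  hcomponent [set: T] H S =
    (S \in [set [set y | connect (share_edge H) x y] | x in [set: T]]).
Proof.
move=> hH; have csym := share_edge_connect_sym H.
have disjU (A : {set T}) :
    (forall E, E \in H -> (E \subset A) || (E \subset ~: A)) ->
    disjoint_union [set: T] H A (hrestrict H A)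
      ([set: T] :\: A) (hrestrict H ([set: T] :\: A)).
  move=> cl; rewrite /disjoint_union setTD setUCr eqxx !hypergraph_restrict //=.
  rewrite -setI_eq0 setICr eqxx /=; apply/eqP/setP=> E; rewrite !inE -andb_orr.
  by case EH: (E \in H) => //=; rewrite cl.
apply/and4P/imsetP => [[/set0Pn[x xS] _ /and5P[_ dS _ _ /eqP HU] cS]|[x _ ->]].
  exists x; rewrite ?inE //; set C := [set y | _].
  have clS E z : E \in H -> z \in E -> z \in S -> E \subset S.
    move=> EH zE zS; have: E \in H by []. rewrite {1}HU !inE EH /=.
    case/orP=> // /subsetP /(_ z zE); by rewrite !inE zS.
  have CS : C \subset S.
    have cl : closed (share_edge H) (mem S).
      apply: intro_closed => // y z /exists_inP[E EH /andP[yE zE]] yS.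
      exact: (subsetP (clS _ _ EH yE yS)).
    by apply/subsetP=> y; rewrite inE => /(closed_connect cl) <-.
  apply/eqP; rewrite eq_sym eqEsubset CS /=.
  (* If [S] were larger than the class [C], then [C] and [S :\: C] would split it. *)
  apply: contraNT cS => nSC.
  apply/existsP; exists C; apply/existsP; exists (hrestrict H C).
  apply/existsP; exists (S :\: C).
  apply/existsP; exists (hrestrict H (S :\: C)).
  apply/and3P; split.
  - by apply/set0Pn; exists x; rewrite inE.
  - by rewrite setD_eq0.
  apply/and5P; split; rewrite ?hypergraph_restrict //.
  - by rewrite -[X in X :|: _](setIidPr CS) setID.
  - by rewrite -setI_eq0; apply/eqP/setP=> y; rewrite !inE; case: connect.
  apply/eqP/setP=> E; rewrite !inE -andb_orr.
  case EH: (E \in H) => //=; apply/idP/orP => [ES|[EC|]].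
  - case/orP: (connect_class_edge x EH) => [->|EC]; [by left|right].
    by rewrite subsetD ES disjoints_subset.
  - exact: subset_trans EC CS.
  - by move=> /subset_trans; apply; rewrite subsetDl.
set C := [set y | _].
have clC := @connect_class_edge H x.
split; [|exact: subsetT|apply: disjU; exact: clC|].
  by apply/set0Pn; exists x; rewrite inE.
apply/negP => /existsP[V1 /existsP[H1 /existsP[V2 /existsP[H2]]]].
case/and3P=> /set0Pn[a aV1] /set0Pn[b bV2] /and5P[/eqP CU dV h1 h2 /eqP HU].
(* An edge meeting [V1] lies in the class, hence in [H1] or [H2], and only [H1] is possible. So no
   path leads from [a] in [V1] to [b] in [V2]. *)
have cl : closed (share_edge H) (mem V1).
  apply: (intro_closed csym) => y z /exists_inP[E EH /andP[yE zE]] yV1.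
  have EC : E \subset C.
    case/orP: (clC _ EH) => // /subsetP /(_ _ yE).
    rewrite inE => /negP[]; rewrite -/C CU inE; apply/orP; left; exact: yV1.
  have: E \in hrestrict H C by rewrite inE EH.
  rewrite HU inE => /orP[EH1|EH2].
    by case/andP: h1 => /forall_inP /(_ _ EH1) /andP[_ /subsetP ->].
  case/andP: h2 => /forall_inP /(_ _ EH2) /andP[_ /subsetP /(_ _ yE) yV2] _.
  by move: dV; rewrite disjoint_subset => /subsetP /(_ _ yV1); rewrite inE yV2.
have xa : connect (share_edge H) x a.
  by have : a \in C; [rewrite CU inE aV1|rewrite inE].
have xb : connect (share_edge H) x b.
  by have : b \in C; [rewrite CU inE bV2 orbT|rewrite inE].
have ab : connect (share_edge H) a b by apply: connect_trans xb; rewrite csym.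
move: dV; rewrite disjoint_subset => /subsetP /(_ b).
have -> : b \in V1 by rewrite -(closed_connect cl ab).
by move/(_ isT); rewrite inE bV2.
Qed.

Lemma ncomponents_roots H : hypergraph [set: T] H ->
  ncomponents [set: T] H = #|roots (share_edge H)|.
Proof.
move=> hH; have csym := share_edge_connect_sym H.
rewrite /ncomponents.
have -> : [set S | hcomponent [set: T] H S] =
   [set [set y | connect (share_edge H) x y] | x in roots (share_edge H)].
  apply/setP=> S; rewrite inE hcomponent_class //; apply/imsetP/imsetP.
    case=> x _ ->; exists (fingraph.root (share_edge H) x).
      exact: roots_root.
    by apply/setP=> y; rewrite !inE; apply/same_connect/connect_root.
  by case=> x _ ->; exists x; rewrite ?inE.
apply: card_in_imset => x y /eqP rx /eqP ry /setP /(_ y).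
by rewrite !inE connect0 -(root_connect csym) rx ry => /eqP.
Qed.

End Components.

(** * The span of the differences of basis vectors along edges *)

Section EdgeSpace.
Local Open Scope ring_scope.
Variables (K : fieldType) (n : nat).
Implicit Types (S : {set {set 'I_n}}).
Local Notation e_ := (fun i : 'I_n => delta_mx 0 i : 'rV[K]_n).

Definition edge_space S : {vspace 'rV[K]_n} :=
  (\sum_(E in S) \sum_(i in E) \sum_(j in E) <[e_ i - e_ j]>)%VS.

Lemma mem_edge_space S E i j :
  E \in S -> i \in E -> j \in E -> e_ i - e_ j \in edge_space S.
Proof.
move=> ES iE jE; apply: (subvP (sumv_sup E ES (subvv _))).
apply: (subvP (sumv_sup i iE (subvv _))).
exact: (subvP (sumv_sup j jE (subvv _))) (memv_line _).
Qed.

Lemma edge_space_connect S i j :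
  connect (share_edge S) i j -> e_ i - e_ j \in edge_space S.
Proof.
case/connectP=> p; elim: p i => [|k p IH] i /=.
  by move=> _ ->; rewrite subrr mem0v.
case/andP=> /exists_inP[E ES /andP[iE kE]] /IH{}IH /IH{}IH.
by rewrite -(subrKA (e_ k)) rpredD // (mem_edge_space ES).
Qed.

Lemma edge_space_subv S (V : {vspace 'rV[K]_n}) :
  (forall E i j, E \in S -> i \in E -> j \in E -> e_ i - e_ j \in V) ->
  (edge_space S <= V)%VS.
Proof.
move=> h; apply/subv_sumP=> E ES; apply/subv_sumP=> i iE.
by apply/subv_sumP=> j jE; rewrite -memvE (h E).
Qed.

(* The map sending e_i to e_(root i) has the edge space as its kernel; the two
   obvious spanning sets bound the dimensions of its kernel and image by the
   numbers of non-roots and of roots, and these bounds add up to n. *)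
Lemma dim_edge_space S :
  \dim (edge_space S) = (n - #|roots (share_edge S)|)%N.
Proof.
have csym := share_edge_connect_sym S.
set r := fingraph.root (share_edge S).
pose M : 'M[K]_n := \matrix_(i, j) (j == r i)%:R.
pose f : 'End('rV[K]_n) := linfun (mulmxr M).
have fE x : f x = \sum_i x 0 i *: e_ (r i).
  rewrite lfunE /=; apply/rowP=> j; rewrite mxE summxE; apply: eq_bigr => i _.
  by rewrite !mxE eqxx.
have fe i : f (e_ i) = e_ (r i).
  rewrite lfunE /= -rowE; apply/rowP=> j; by rewrite !mxE eqxx.
have Ukf : (edge_space S <= lker f)%VS.
  apply: edge_space_subv => E i j ES iE jE.
  rewrite memv_ker linearB /= !fe subr_eq0; apply/eqP; congr (delta_mx 0 _).
  apply/eqP; rewrite /r root_connect //; apply: connect1.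
  by apply/exists_inP; exists E => //; rewrite iE.
pose X := [seq e_ i - e_ (r i) | i <- enum (predC (roots (share_edge S)))].
have kfX : (lker f <= <<X>>)%VS.
  apply/subvP=> x; rewrite memv_ker => /eqP fx0.
  (* Subtracting [f x], which vanishes, from the expansion of [x] in the basis gives this form; the
     terms of the roots are zero. *)
  have -> : x = \sum_i x 0 i *: (e_ i - e_ (r i)).
    under eq_bigr do rewrite scalerBr; rewrite sumrB -fE fx0 subr0.
    exact: row_sum_delta.
  apply: rpred_sum => i _; apply: rpredZ.
  have [ri|ri] := boolP (i \in roots (share_edge S)).
    by rewrite /r (eqP ri) subrr mem0v.
  by apply/memv_span/mapP; exists i; rewrite // mem_enum inE.
have XU : (<<X>> <= edge_space S)%VS.
  apply/span_subvP=> _ /mapP[i _ ->]; apply: edge_space_connect.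
  exact: connect_root.
have UX : edge_space S = <<X>>%VS.
  by apply/eqP; rewrite eqEsubv XU (subv_trans Ukf kfX).
have dX : (\dim (edge_space S) <= #|predC (roots (share_edge S))|)%N.
  by rewrite UX (leq_trans (dim_span _)) // size_map -cardE.
have UE : edge_space S = lker f.
  by apply/eqP; rewrite eqEsubv Ukf UX kfX.
have dimg : (\dim (limg f) <= #|roots (share_edge S)|)%N.
  have -> : #|roots (share_edge S)| =
      size [seq e_ i | i <- enum (roots (share_edge S))].
    by rewrite size_map -cardE.
  apply: leq_trans (dim_span _); apply: dimvS.
  apply/subvP=> _ /memv_imgP[x _ ->]; rewrite fE.
  apply: rpred_sum => i _; apply/rpredZ/memv_span/mapP; exists (r i) => //.
  by rewrite mem_enum; exact: roots_root.
have := limg_ker_dim f fullv; rewrite capfv -UE dimvf /dim /= mul1n => dE.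
have := cardC (roots (share_edge S)); rewrite card_ord => cE.
have -> : (n - #|roots (share_edge S)| = #|predC (roots (share_edge S))|)%N.
  by rewrite -[X in (X - _)%N]cE addKn.
apply/eqP; rewrite eqn_leq dX -(leq_add2l #|roots (share_edge S)|) cE.
by rewrite -[leqLHS]dE addnC leq_add2r.
Qed.

End EdgeSpace.

(** * Flags *)

Section Flags.
Variable T : finType.
Implicit Types (F : seq {set T}) (i j : T) (a b : nat).

(** The number, counted from 0, of the block containing [i]. Flags are handled below through the
    total preorder that this index induces on the vertices. *)
Definition flag_index F i : nat := find (fun A : {set T} => i \in A) F.

Lemma flag_index_lt F i : is_flag F -> flag_index F i < size F.
Proof.
case/andP=> _ /eqP lF; rewrite -has_find; apply/hasP; exists (last set0 F).
  case: F lF => [|A F _] /=; last exact: mem_last.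
  by move/setP/(_ i); rewrite !inE.
by rewrite lF inE.
Qed.

Lemma proper_trans_rel : transitive (fun A B : {set T} => A \proper B).
Proof. by move=> ? ? ?; apply: proper_trans. Qed.

Lemma in_flag F a i :
  is_flag F -> a < size F -> (i \in nth set0 F a) = (flag_index F i <= a).
Proof.
move=> fF aF; apply/idP/idP => [iFa|].
  by rewrite leqNgt; apply: contraL iFa => /(before_find set0) ->.
have iF : i \in nth set0 F (flag_index F i).
  apply: (nth_find set0 (a := fun A : {set T} => i \in A)).
  by rewrite has_find flag_index_lt.
rewrite leq_eqVlt => /predU1P[<- //|ia].
have /path_sorted sF : path (fun A B : {set T} => A \proper B) set0 F.
  by case/andP: fF.
have := sorted_ltn_nth proper_trans_rel set0 sF.
move/(_ _ _ (flag_index_lt i fF) aF ia).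
by move=> /proper_sub/subsetP; apply.
Qed.

(** Prepending [set0] shifts positions by one, so position [a] now holds the predecessor of the
    member [nth set0 F a]; hence the strict inequality. *)
Lemma nth_cons_flag F a i : is_flag F -> a <= size F ->
  (i \in nth set0 (set0 :: F) a) = (flag_index F i < a).
Proof. by move=> fF; case: a => [|a] aF; rewrite /= ?inE // in_flag. Qed.

Lemma flag_blockE F a :
  is_flag F -> flag_block F a = [set i | flag_index F i == a].
Proof.
move=> fF; apply/setP=> i; rewrite inE /flag_block /flag_blocks.
have [aF|aF] := ltnP a (size F).
  rewrite (nth_pairmap set0) // in_setD nth_cons_flag ?(ltnW aF) // in_flag //.
  by rewrite -leqNgt andbC -eqn_leq.
rewrite nth_default ?size_pairmap // inE.
by apply/esym/negbTE; rewrite neq_ltn (leq_trans (flag_index_lt i fF)).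
Qed.

Lemma flag_index_surj F a :
  is_flag F -> a < size F -> exists i, flag_index F i = a.
Proof.
move=> fF aF.
have /andP[/(pathP set0) /(_ a aF) /properP[_ [i iF niF]] _] := fF.
exists i; apply/eqP; rewrite eqn_leq -in_flag // iF /=.
by rewrite leqNgt -nth_cons_flag // ltnW.
Qed.

Lemma mem_flagP F A : is_flag F ->
  reflect (exists i, A = [set j | flag_index F j <= flag_index F i]) (A \in F).
Proof.
move=> fF; apply: (iffP (nthP set0)) => [[a aF <-]|[i ->]].
  have [i ia] := flag_index_surj fF aF; exists i.
  by apply/setP=> j; rewrite inE in_flag // ia.
exists (flag_index F i); first exact: flag_index_lt.
by apply/setP=> j; rewrite inE in_flag // flag_index_lt.
Qed.

(** The members of a flag are the principal down-sets of its preorder, and a strictly increasing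
    sequence is determined by its members. *)
Lemma flag_index_inj F G : is_flag F -> is_flag G ->
  (forall i j, (flag_index F i <= flag_index F j) =
               (flag_index G i <= flag_index G j)) -> F = G.
Proof.
move=> fF fG FG; apply: (irr_sorted_eq proper_trans_rel).
- by move=> A; rewrite properxx.
- by case/andP: fF => /path_sorted.
- by case/andP: fG => /path_sorted.
move=> A; apply/mem_flagP/mem_flagP => // -[i ->]; exists i; apply/setP=> j;
  by rewrite !inE FG.
Qed.

(** Blocks are nonempty and disjoint, so choosing a vertex in each of them is injective. *)
Lemma size_flag F : is_flag F -> size F <= #|T|.
Proof.
move=> fF; have /fin_all_exists[f fE] (a : 'I_(size F)) :
    exists i, flag_index F i = a by apply: flag_index_surj.
have fI : injective f by move=> a b fab; apply: ord_inj; rewrite -!fE fab.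
by rewrite -[X in X <= _]card_ord; apply: leq_card fI.
Qed.

Lemma flag_index_leP F i j : is_flag F ->
  reflect (forall A, A \in F -> j \in A -> i \in A)
          (flag_index F i <= flag_index F j).
Proof.
move=> fF; apply: (iffP idP) => [ij _ /(mem_flagP _ fF)[k ->]|h].
  by rewrite !inE; apply: leq_trans.
have := h [set k | flag_index F k <= flag_index F j]; rewrite !inE; apply=> //.
by apply/mem_flagP => //; exists j.
Qed.

(** * The flag of sublevel sets of a function *)

Section Level.
Variables (d : Order.disp_t) (O : orderType d) (w : T -> O).
Local Notation level := (fun i => [set j | (w j <= w i)%O]).

(** Vertices with equal values have the same sublevel set, so [undup] leaves one set per value;
    inclusion orders these sets totally. *)
Definition level_flag : seq {set T} :=
  sort (fun A B : {set T} => A \subset B) (undup (codom level)).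

Lemma mem_level_flag A : reflect (exists i, A = level i) (A \in level_flag).
Proof. by rewrite mem_sort mem_undup; apply: (iffP codomP). Qed.

Lemma level_subset i j : (level i \subset level j) = (w i <= w j)%O.
Proof.
apply/subsetP/idP => [/(_ i)|ij k]; first by rewrite !inE lexx; apply.
by rewrite !inE => /le_trans; apply.
Qed.

Lemma level_flag_sorted : sorted (fun A B : {set T} => A \proper B) level_flag.
Proof.
have : sorted (fun A B : {set T} => A \subset B) level_flag.
  apply: (@sort_sorted_in _ [in codom level]) => [A B|].
    by move=> /codomP[i ->] /codomP[j ->]; rewrite !level_subset le_total.
  by apply/allP=> A; rewrite mem_undup.
have : uniq level_flag by rewrite sort_uniq undup_uniq.
have tr : transitive (fun A B : {set T} => A \subset B).
  by move=> ? ? ?; apply: subset_trans.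
rewrite (sorted_pairwise tr) (sorted_pairwise proper_trans_rel) uniq_pairwise.
move=> u s.
have : pairwise (fun A B : {set T} => (A \subset B) && (A != B)) level_flag.
  by rewrite pairwise_relI s u.
by apply: sub_pairwise => A B; rewrite properEneq andbC.
Qed.

Lemma level_flagP : is_flag level_flag.
Proof.
have sF := level_flag_sorted; have mF := mem_level_flag.
apply/andP; split.
  move: sF mF; case: level_flag => //= A F -> mF; rewrite andbT.
  have [i ->] : exists i, A = level i by apply/mF; rewrite mem_head.
  by rewrite proper0; apply/set0Pn; exists i; rewrite inE lexx.
rewrite eqEsubset subsetT /=; apply/subsetP=> i _.
have /mF : exists j, level i = level j by exists i.
have iL : i \in level i by rewrite inE lexx.
move: sF; case/lastP: level_flag => // F A; rewrite last_rcons.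
rewrite (sorted_pairwise proper_trans_rel) pairwise_rcons => /andP[/allP AF _].
rewrite mem_rcons inE => /predU1P[<- //|/AF /proper_sub/subsetP]; exact.
Qed.

Lemma level_flag_index i j :
  (flag_index level_flag i <= flag_index level_flag j) = (w i <= w j)%O.
Proof.
apply/(flag_index_leP _ _ level_flagP)/idP => [|ij A /mem_level_flag[k ->]].
  move/(_ (level j)); rewrite !inE lexx; apply=> //.
  by apply/mem_level_flag; exists j.
by rewrite !inE; apply: le_trans.
Qed.

End Level.
End Flags.

(** * Maximizers on hyperedges and the splitting hypergraph *)

Section Argmax.
Variables (T : finType) (d : Order.disp_t) (O : orderType d) (w : T -> O).
Implicit Types (E : {set T}) (H : {set {set T}}) (F : seq {set T}).

Definition argmax_set E : {set T} :=
  [set i in E | [forall j in E, (w j <= w i)%O]].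

Lemma argmax_setP E i :
  reflect (i \in E /\ forall j, j \in E -> (w j <= w i)%O) (i \in argmax_set E).
Proof. by rewrite inE; apply: (iffP andP) => -[iE /forall_inP]. Qed.

Lemma argmax_set_eq0 E : (argmax_set E == set0) = (E == set0).
Proof.
apply/eqP/eqP => [|->]; last by apply/setP=> i; rewrite !inE.
apply: contra_eq => /set0Pn[i0 i0E]; apply/set0Pn.
have [i iE im] := @arg_maxP _ _ T i0 [in E] w i0E.
by exists i; apply/argmax_setP.
Qed.

Lemma argmax_hypergraph H : hypergraph [set: T] H ->
  hypergraph [set: T] [set argmax_set E | E in H].
Proof.
case/andP=> /forall_inP hH /forall_inP sH; apply/andP; split.
  apply/forall_inP=> _ /imsetP[E /hH /andP[E0 _] ->].
  by rewrite argmax_set_eq0 E0 subsetT.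
apply/forall_inP=> x xT; apply/imsetP; exists [set x]; first exact: sH.
apply/setP=> y; apply/set1P/argmax_setP => [->|[/set1P -> //]].
by split=> [|j /set1P -> //]; rewrite set11.
Qed.

(** A hyperedge contributes to exactly one block, the highest one it meets: at lower positions it is
    not contained in the member of the flag, at higher ones it contracts to the empty set. What
    survives is its part in that block, the set of its maximizers. *)
Lemma splitting_argmax H F : is_flag F -> set0 \notin H ->
  (forall i j, (w i <= w j)%O = (flag_index F i <= flag_index F j)) ->
  splitting H F = [set argmax_set E | E in H].
Proof.
move=> fF H0 wF.
have topE a E : a < size F -> E \subset nth set0 F a ->
    E :\: nth set0 (set0 :: F) a != set0 ->
    argmax_set E = E :\: nth set0 (set0 :: F) a.
  move=> aF /subsetP EF /set0Pn[k /setDP[kE kF]].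
  apply/setP=> i; rewrite in_setD nth_cons_flag ?(ltnW aF) // -leqNgt.
  apply/argmax_setP/andP => [[iE im]|[ai iE]]; split=> //.
    rewrite nth_cons_flag ?(ltnW aF) // -leqNgt in kF.
    by apply: leq_trans kF _; rewrite -wF im.
  move=> j jE; rewrite wF; apply: leq_trans ai.
  by rewrite -in_flag // EF.
have inS X : (X \in splitting H F) = [exists a : 'I_(size F),
    X \in hcontract (hrestrict H (nth set0 F a)) (nth set0 (set0 :: F) a)].
  rewrite /splitting (big_nth set0) size_pairmap big_mkord.
  apply/bigcupP/existsP => -[a]; first move=> _.
    by rewrite (nth_pairmap set0) // => ?; exists a.
  by exists a => //; rewrite (nth_pairmap set0).
apply/setP=> X; rewrite inS; apply/existsP/imsetP => [[a]|[E EH ->]].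
  rewrite in_setD1 => /andP[X0 /imsetP[E]]; rewrite inE => /andP[EH EF] XE.
  by exists E => //; rewrite XE (topE a) // -XE.
have : argmax_set E != set0.
  by rewrite argmax_set_eq0; apply: contraNneq H0 => <-.
case/set0Pn=> i iM; have [iE im] := argmax_setP _ _ iM.
have aF := flag_index_lt i fF.
have EF : E \subset nth set0 F (flag_index F i).
  by apply/subsetP=> j jE; rewrite in_flag // -wF im.
have E0 : E :\: nth set0 (set0 :: F) (flag_index F i) != set0.
  apply/set0Pn; exists i.
  by rewrite in_setD iE nth_cons_flag ?(ltnW aF) // ltnn.
exists (Ordinal aF); rewrite in_setD1 /= (topE _ _ aF EF E0) E0 /=.
by apply/imsetP; exists E => //; rewrite inE EH.
Qed.

End Argmax.

From mathcomp Require Import finmap.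
From mathcomp.multinomials Require Import monalg.
From mathcomp Require Import all_classical reals topology normedtype.
Import numFieldNormedType.Exports.

Local Open Scope classical_set_scope.
Local Open Scope ring_scope.

(** * Faces of hypergraphic polytopes *)

Section AffineGeometry.
Variables (R : realType) (n : nat).
Local Notation vec := 'rV[R]_n.
Implicit Types (A Q G : set vec) (w x y : vec).

Lemma dotvDl w1 w2 x : dotv (w1 + w2) x = dotv w1 x + dotv w2 x.
Proof. by rewrite -big_split; apply: eq_bigr => i _; rewrite mxE mulrDl. Qed.

Lemma dotvZl c w x : dotv (c *: w) x = c * dotv w x.
Proof. by rewrite mulr_sumr; apply: eq_bigr => i _; rewrite mxE mulrA. Qed.

Lemma dotv_suml (I : finType) (v : I -> vec) x :
  dotv (\sum_i v i) x = \sum_i dotv (v i) x.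
Proof.
rewrite exchange_big; apply: eq_bigr => i _.
by rewrite summxE mulr_suml.
Qed.

Lemma dotv_sumr (I : finType) (P : pred I) w (v : I -> vec) :
  dotv w (\sum_(i | P i) v i) = \sum_(i | P i) dotv w (v i).
Proof.
rewrite exchange_big; apply: eq_bigr => i _.
by rewrite summxE mulr_sumr.
Qed.

Lemma dotvDr w x y : dotv w (x + y) = dotv w x + dotv w y.
Proof. by rewrite -big_split; apply: eq_bigr => i _; rewrite mxE mulrDr. Qed.

Lemma dotv_delta w i : dotv w (delta_mx 0 i) = w 0 i.
Proof.
rewrite /dotv (bigD1 i) //= mxE !eqxx mulr1 big1 ?addr0 // => j ji.
by rewrite mxE eqxx (negbTE ji) mulr0.
Qed.

(** The direction space consists of the differences of points of the hull, so it does not depend on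
    the base point and the choice made by [xget] is forced. *)
Lemma affine_dimE A (a : vec) (U : {vspace vec}) :
  affine_hull A = [set x | x - a \in U] -> affine_dim A = \dim U.
Proof.
move=> AU; apply: xget_subset1; first by exists a, U.
move=> _ _ [a1 [U1 [E1 <-]]] [a2 [U2 [E2 <-]]]; congr (\dim _).
have sub (b b' : vec) (V V' : {vspace vec}) :
    affine_hull A = [set x | x - b \in V] ->
    affine_hull A = [set x | x - b' \in V'] -> (V <= V')%VS.
  move=> EV EV'; apply/subvP=> u uV.
  have h0 : affine_hull A b by rewrite EV /= subrr mem0v.
  have h1 : affine_hull A (b + u) by rewrite EV /= addrC addKr.
  move: h0 h1; rewrite EV' /= => h0 h1.
  have -> : u = (b + u - b') - (b - b').
    by rewrite opprB addrA subrK addrC addKr.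
  exact: rpredB.
by apply/eqP; rewrite eqEsubv (sub _ _ _ _ E1 E2) (sub _ _ _ _ E2 E1).
Qed.

Lemma subset_affine_hull A : A `<=` affine_hull A.
Proof.
move=> x Ax; exists 1%N, (fun=> 1), (fun=> x); split=> //.
  by rewrite big_ord1.
by rewrite big_ord1 scale1r.
Qed.

Lemma affine_hull_translate A x g1 g2 c :
  A g1 -> A g2 -> affine_hull A x -> affine_hull A (x + c *: (g1 - g2)).
Proof.
move=> A1 A2 [k [a [p [pA a1 ->]]]].
(* Two entries are put in front of the combination: the points [g1] and [g2] with weights [c] and
   [- c], which leave the total weight equal to 1. *)
pose ext X (x1 x2 : X) (f : 'I_k -> X) (i : 'I_k.+2) : X :=
  if unlift ord0 i is Some j then
    if unlift ord0 j is Some l then f l else x2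
  else x1.
exists k.+2, (ext R c (- c) a), (ext vec g1 g2 p); split.
- by move=> i; rewrite /ext; case: unliftP => // j _; case: unliftP.
- rewrite !big_ord_recl /ext unlift_none liftK unlift_none.
  under eq_bigr do rewrite !liftK.
  by rewrite a1 addrA subrr add0r.
- rewrite !big_ord_recl /ext unlift_none liftK unlift_none.
  under [in RHS]eq_bigr do rewrite !liftK.
  by rewrite addrA scaleNr scalerBr addrC.
Qed.

Lemma sumv_ind (I : finType) (D : pred I) (V : I -> {vspace vec})
    (P : vec -> Prop) :
  P 0 -> (forall u v, P u -> P v -> P (u + v)) ->
  (forall i, D i -> forall u, u \in V i -> P u) ->
  forall u, u \in (\sum_(i | D i) V i)%VS -> P u.
Proof.
move=> P0 PD PV u /memv_sumP[v vV ->].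
by apply: (big_ind P) => // i Di; apply: PV (vV _ Di).
Qed.

Lemma max_face_dotv Q w x y : max_face Q w x -> max_face Q w y ->
  dotv w x = dotv w y.
Proof. by move=> [Qx hx] [Qy hy]; apply/le_anti; rewrite hx ?hy. Qed.

(* If w is in the relative interior, the segment from w' to w may be prolonged
   a little beyond w inside the normal cone of the face cut out by w'. *)
Lemma relative_interior_normal_cone Q w w' : max_face Q w' !=set0 ->
  relative_interior (normal_cone Q (max_face Q w')) w ->
  max_face Q w' = max_face Q w.
Proof.
move=> [g Gg] [Nw near_w]; apply/seteqP; split=> // x xw.
have [Qg gw'] := Gg; have [Qx xwm] := xw.
have [t t0 Nt] : exists2 t : R, 0 < t &
    normal_cone Q (max_face Q w') (w + t *: (w - w')).
  have cv : w + t *: (w - w') @[t --> (0 : R)] --> w + (0 : R) *: (w - w').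
    by apply: cvgD; [exact: cvg_cst|exact: scalel_continuous].
  rewrite scale0r addr0 in cv.
  have /nbhs_ballP[e /= e0 eP] := cv _ near_w.
  exists (e / 2); first by rewrite divr_gt0.
  apply: eP => /=.
    rewrite /ball /= sub0r normrN gtr0_norm ?divr_gt0 //.
    by rewrite gtr_pMr ?invf_lt1 ?ltr1n.
  by apply: affine_hull_translate => //; apply: subset_affine_hull.
split=> // y Qy; apply: le_trans (gw' y Qy) _.
(* The points [x] and [g] tie for [w], while the prolonged direction is maximal at [g]. As [w']
   enters that direction with coefficient [- t], it is at least as large at [x] as at [g]. *)
have [_ /(_ _ Qx)] := Nt _ Gg.
have wg : dotv w x = dotv w g by apply: max_face_dotv xw (Nw _ Gg).
have dB v : dotv (w - w') v = dotv w v - dotv w' v.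
  by rewrite dotvDl -scaleN1r dotvZl mulN1r.
by rewrite !dotvDl !dotvZl !dB wg lerD2l ler_pM2l // lerD2l lerN2.
Qed.

End AffineGeometry.

(** * Maximal faces of Minkowski sums of simplices *)

Section HypergraphicPolytope.
Variables (R : realType) (n : nat).
Local Notation vec := 'rV[R]_n.
Local Notation e_ := (fun i : 'I_n => delta_mx 0 i : 'rV[R]_n).
Local Notation top w := (argmax_set (fun i => (w : 'rV[R]_n) 0 i)).
Implicit Types (w x y p : vec) (E : {set 'I_n}) (H : {set {set 'I_n}}).

Lemma simplex_coord E p : simplex R E p ->
  [/\ forall j, 0 <= p 0 j, \sum_j p 0 j = 1
    & forall j, j \notin E -> p 0 j = 0].
Proof.
move=> [k [a [q [qE a0 a1 ->]]]].
have /fin_all_exists2[f fE qf] : forall i, exists2 j, j \in E & e_ j = q i.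
  by move=> i; have [j jE <-] := qE i; exists j.
have coord j : (\sum_(i < k) a i *: q i) 0 j = \sum_(i < k) a i * (f i == j)%:R.
  by rewrite summxE; apply: eq_bigr => i _; rewrite -qf !mxE eqxx eq_sym.
split=> [j||j jE].
- by rewrite coord; apply: sumr_ge0 => i _; rewrite mulr_ge0.
- under eq_bigr do rewrite coord.
  rewrite exchange_big -[RHS]a1 /=; apply: eq_bigr => i _.
  rewrite (bigD1 (f i)) //= eqxx mulr1 big1 ?addr0 // => j.
  by rewrite eq_sym => /negbTE ->; rewrite mulr0.
- rewrite coord big1 // => i _; have [fj|] := eqVneq; last by rewrite mulr0.
  by rewrite -fj fE in jE.
Qed.

Lemma simplex_delta E i : i \in E -> simplex R E (e_ i).
Proof.
move=> iE; exists 1%N, (fun=> 1), (fun=> e_ i); split=> //.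
- by move=> _; exists i.
- by rewrite big_ord1.
- by rewrite big_ord1 scale1r.
Qed.

(** The coordinates of [p] sum to 1. When [i] is a maximizer on [E], all terms on the right are
    nonnegative, which yields both the bound and the equality case below. *)
Lemma simplex_dotv E p w i : simplex R E p ->
  w 0 i - dotv w p = \sum_(j in E) (w 0 i - w 0 j) * p 0 j.
Proof.
move=> /simplex_coord[_ p1 pE]; rewrite -{1}[w 0 i]mulr1 -p1 mulr_sumr -sumrB.
rewrite [RHS]big_mkcond; apply: eq_bigr => j _; rewrite -mulrBl.
by case: ifPn => // /pE ->; rewrite mulr0.
Qed.

Lemma simplex_dotv_le E p w i : simplex R E p -> i \in top w E ->
  dotv w p <= w 0 i.
Proof.
move=> sp iM; rewrite -subr_ge0 (simplex_dotv w i sp).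
have [p0 _ _] := simplex_coord sp; have [_ im] := argmax_setP _ _ _ iM.
by apply: sumr_ge0 => j jE; rewrite mulr_ge0 ?subr_ge0 ?im.
Qed.

Lemma simplex_dotv_max E p w i : simplex R E p -> i \in top w E ->
  dotv w p = w 0 i <-> forall j, j \notin top w E -> p 0 j = 0.
Proof.
move=> sp iM; have [p0 _ pE] := simplex_coord sp.
have [iE im] := argmax_setP _ _ _ iM.
split=> [wp j jM|pM].
  have [jE|/pE//] := boolP (j \in E).
  have ge0 k : k \in E -> 0 <= (w 0 i - w 0 k) * p 0 k.
    by move=> kE; rewrite mulr_ge0 ?subr_ge0 ?im.
  have := simplex_dotv w i sp; rewrite wp subrr => /esym /(psumr_eq0P ge0).
  move=> /(_ j jE) /eqP; rewrite mulf_eq0 => /orP[|/eqP//].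
  rewrite subr_eq0 => /eqP ij; case/negP: jM; apply/argmax_setP; split=> //.
  by rewrite -ij.
apply/eqP; rewrite eq_sym -subr_eq0 (simplex_dotv w i sp) big1 // => j jE.
have [jM|/pM->] := boolP (j \in top w E); last by rewrite mulr0.
have [_ jm] := argmax_setP _ _ _ jM.
suff -> : w 0 i = w 0 j by rewrite subrr mul0r.
by apply/le_anti; rewrite im ?jm.
Qed.

Section Face.
Variables (H : {set {set 'I_n}}) (hypH : hypergraph [set: 'I_n] H).
Local Notation Q := (hypergraphic_polytope R H).

Lemma argmax_edge w E : E \in H -> exists i, i \in top w E.
Proof.
case/andP: hypH => /forall_inP hH _ /hH /andP[E0 _].
by apply/set0Pn; rewrite argmax_set_eq0.
Qed.

(** A choice of one vertex in the top face of each summand. Its sum lies in the face maximizing [w],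
    though it need not be a vertex of that face, and serves as a base point. *)
Definition vertex_family w (p : {set 'I_n} -> vec) :=
  forall E, E \in H -> exists2 i, i \in top w E & p E = e_ i.

Lemma vertex_family_ex w : exists p : {set 'I_n} -> vec, vertex_family w p.
Proof.
exists (fun E => if [pick i in top w E] is Some i then e_ i else 0) => E EH.
case: pickP => [i iM|M0]; first by exists i.
by have [i] := argmax_edge w EH; rewrite M0.
Qed.

(** The functional is additive and each summand is bounded by its value at a top vertex, so the sum
    is maximal exactly when every summand is. *)
Lemma max_faceP w x : max_face Q w x <->
  exists p : {set 'I_n} -> vec,
    [/\ forall E, E \in H -> simplex R E (p E),
        forall E j, E \in H -> j \notin top w E -> p E 0 j = 0
      & x = \sum_(E in H) p E].
Proof.
have [p0 p0E] := vertex_family_ex w.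
have le_p0 p E : E \in H -> simplex R E p -> dotv w p <= dotv w (p0 E).
  move=> EH sp; have [i iM ->] := p0E E EH.
  by rewrite dotv_delta (simplex_dotv_le sp).
split=> [[[p [ps ->]] hx]|[p [ps pM ->]]].
  exists p; split=> // E j EH jM.
  have Q0 : Q (\sum_(E in H) p0 E).
    exists p0; split=> // D DH; have [i iM ->] := p0E D DH.
    by apply: simplex_delta; case/argmax_setP: iM.
  have := hx _ Q0; rewrite !dotv_sumr => le0.
  have ge0 D : D \in H -> 0 <= dotv w (p0 D) - dotv w (p D).
    by move=> DH; rewrite subr_ge0 le_p0 //; apply: ps.
  have /(psumr_eq0P ge0)/(_ E EH)/eqP :
      \sum_(D in H) (dotv w (p0 D) - dotv w (p D)) = 0.
    apply/le_anti; rewrite sumr_ge0 // andbT sumrB subr_le0; exact: le0.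
  rewrite subr_eq0; have [i iM ->] := p0E E EH; rewrite dotv_delta => /eqP wi.
  by apply: (simplex_dotv_max (ps E EH) iM).1.
split; first by exists p.
move=> _ [r [rs ->]]; rewrite !dotv_sumr; apply: ler_sum => E EH.
apply: le_trans (le_p0 _ _ EH (rs E EH)) _.
have [i iM ->] := p0E E EH; rewrite dotv_delta.
by rewrite (simplex_dotv_max (ps E EH) iM).2 // => j; apply: pM.
Qed.

Lemma vertex_family_face w (p : {set 'I_n} -> vec) :
  vertex_family w p -> max_face Q w (\sum_(E in H) p E).
Proof.
move=> pV; apply/max_faceP; exists p; split=> // E => [EH|j EH jM].
  by have [i /argmax_setP[iE _] ->] := pV E EH; apply: simplex_delta.
have [i iM ->] := pV E EH; rewrite mxE; have [ji|] := eqVneq j i.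
  by rewrite ji iM in jM.
by rewrite andbF.
Qed.

(** Changing the vertex chosen for one hyperedge stays in the face; two such changes differ by a
    generator [e_ i - e_ j] of the edge space. *)
Lemma vertex_family_exchange w (p : {set 'I_n} -> vec) E i :
  vertex_family w p -> E \in H ->
  i \in top w E -> max_face Q w (\sum_(D in H) p D + (e_ i - p E)).
Proof.
move=> pV EH iM.
have -> : \sum_(D in H) p D + (e_ i - p E) =
    \sum_(D in H) (if D == E then e_ i else p D).
  rewrite (bigD1 E) //= [RHS](bigD1 E) //= eqxx [LHS]addrC addrA subrK.
  by congr (_ + _); apply: eq_bigr => D /andP[_ /negbTE ->].
apply: vertex_family_face => D DH; case: eqP => [->|_]; last exact: pV.
by exists i.
Qed.

Lemma max_face_argmax_le w w' :
  (forall E, E \in H -> top w E \subset top w' E) ->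
  max_face Q w `<=` max_face Q w'.
Proof.
move=> ww' x /max_faceP[p [ps pM ->]]; apply/max_faceP; exists p; split=> //.
move=> E j EH jM; apply: pM => //; apply: contraNN jM.
by move/(fintype.subsetP (ww' E EH)).
Qed.

Lemma affine_hull_max_face w (p : {set 'I_n} -> vec) : vertex_family w p ->
  affine_hull (max_face Q w) =
    [set x | x - \sum_(E in H) p E
               \in edge_space R [set top w E | E in H]%SET].
Proof.
move=> pV; set a := \sum_(E in H) p E; set S := [set _ | _ in _]%SET.
have aG : max_face Q w a by apply: vertex_family_face.
apply/seteqP; split=> [_ [k [c [q [qG c1 ->]]]] /=|x /= xU].
  have -> : \sum_(i < k) c i *: q i - a = \sum_(i < k) c i *: (q i - a).
    under [RHS]eq_bigr do rewrite scalerBr.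
    by rewrite sumrB -scaler_suml c1 scale1r.
  apply: rpred_sum => i _; apply: rpredZ.
  have /max_faceP[r [rs rM ->]] := qG i; rewrite -sumrB.
  apply: rpred_sum => E EH; have [l lM ->] := pV E EH.
  have [_ r1 _] := simplex_coord (rs E EH).
  (* Since the coordinates of [r E] sum to 1, the difference [r E - e_ l] is a combination of the
     [e_ j - e_ l], with zero weight off the maximizers. *)
  rewrite [r E]row_sum_delta -[X in _ - X]scale1r -r1 scaler_suml -sumrB.
  apply: rpred_sum => j _; rewrite -scalerBr.
  have [jM|/(rM _ _ EH)->] := boolP (j \in top w E); last first.
    by rewrite scale0r mem0v.
  apply/rpredZ/(@mem_edge_space _ _ S (top w E)) => //.
  by apply/imsetP; exists E.
rewrite -(subrK a x) addrC.
(* The translations preserving the hull are closed under addition, so it suffices to treat multiples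
   of the generators of the edge space. *)
pose P u := forall y, affine_hull (max_face Q w) y ->
  affine_hull (max_face Q w) (y + u).
have P0 : P 0 by move=> y; rewrite addr0.
have PD u v : P u -> P v -> P (u + v) by move=> Pu Pv y /Pu/Pv; rewrite addrA.
suff : P (x - a) by apply; apply: subset_affine_hull.
move: (x - a) xU; apply: sumv_ind => // _ /imsetP[E EH ->].
apply: sumv_ind => // i iM; apply: sumv_ind => // j jM _ /vlineP[c ->] y yG.
have -> : e_ i - e_ j = (a + (e_ i - p E)) - (a + (e_ j - p E)).
  by rewrite opprD addrACA subrr add0r opprB addrA subrK.
by apply: affine_hull_translate => //; apply: vertex_family_exchange.
Qed.

(** Near [w] all strict inequalities between coordinates persist. A point in the affine hull of the
    normal cone is also constant on the face, which preserves ties between maximizers on a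
    hyperedge. Hence maximizers for [w] remain maximizers. *)
Lemma relative_interior_max_face w :
  relative_interior (normal_cone Q (max_face Q w)) w.
Proof.
split=> //.
pose P (ij : 'I_n * 'I_n) (y : vec) :=
  w 0 ij.1 < w 0 ij.2 -> y 0 ij.1 < y 0 ij.2.
have : \forall y \near w, forall ij, P ij y.
  apply: (@filter_forall _ _ P (nbhs w) _) => -[i j]; rewrite /P /=.
  have [ij|_] := boolP (w 0 i < w 0 j); last exact: nearW.
  have : \forall y \near w, 0 < (y : vec) 0 j - y 0 i.
    have cv : y 0 j - y 0 i @[y --> w] --> w 0 j - w 0 i.
      by apply: cvgB; apply: coord_continuous.
    by apply: (cvgr_gt _ cv); rewrite subr_gt0.
  by apply: filterS => y; rewrite subr_gt0.
apply: filterS => y ylt [k [c [v [vN c1 yE]]]].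
have dotG g g' : max_face Q w g -> max_face Q w g' -> dotv y g = dotv y g'.
  move=> Gg Gg'; rewrite yE !dotv_suml; apply: eq_bigr => l _.
  by rewrite !dotvZl (max_face_dotv (vN l _ Gg) (vN l _ Gg')).
apply: max_face_argmax_le => E EH; apply/fintype.subsetP=> i iM.
have [iE im] := argmax_setP _ _ _ iM; apply/argmax_setP; split=> // j jE.
have := im j jE; rewrite le_eqVlt => /predU1P[ji|/(ylt (j, i))/ltW//].
have jM : j \in top w E.
  by apply/argmax_setP; split=> // l lE; rewrite ji im.
have [p pV] := vertex_family_ex w.
(* These two points of the face differ by [e_ i - e_ j], so equal values of [y] on them give equal
   coordinates. *)
have := dotG _ _ (vertex_family_exchange pV EH iM)
                 (vertex_family_exchange pV EH jM).
by rewrite !dotvDr !dotv_delta => /addrI/addIr ->.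
Qed.

(** * Braid cones and the faces indexed by flags *)

Lemma braid_coneP F w : is_flag F -> braid_cone F w <->
  forall i j, (w 0 i <= w 0 j) = (flag_index F i <= flag_index F j)%N.
Proof.
move=> fF; split=> [wF i j|wF a b i j].
  have bl l : l \in flag_block F (flag_index F l) by rewrite flag_blockE // inE.
  have [ij|ij|ij] := ltngtP (flag_index F i) (flag_index F j).
  - by rewrite ltW // (wF _ _ _ _ (bl i) (bl j)).2.
  - by apply/negbTE; rewrite -ltNge (wF _ _ _ _ (bl j) (bl i)).2.
  - by rewrite ((wF _ _ _ _ (bl i) (bl j)).1 ij) lexx.
rewrite !flag_blockE // !inE => /eqP <- /eqP <-; split=> [ij|].
  by apply/le_anti; rewrite !wF ij leqnn.
by rewrite !ltNge wF -ltnNge.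
Qed.

(** All points of the braid cone have the same maximizers on each hyperedge, hence cut out the same
    face, which therefore qualifies. Uniqueness holds because a face having [w] in the relative
    interior of its normal cone is the face cut out by [w]. *)
Lemma face_of_flagE F w :
  is_flag F -> braid_cone F w -> face_of_flag Q F = max_face Q w.
Proof.
move=> fF wF; apply: xget_subset1.
  split; first by exists w.
  move=> w' w'F; suff -> : max_face Q w = max_face Q w'.
    exact: relative_interior_max_face.
  have topE E : top w E = top w' E.
    apply/setP=> i; rewrite !inE; congr (_ && _); apply: eq_forallb => j.
    by rewrite (braid_coneP _ fF).1 // (braid_coneP _ fF).1.
  by apply/seteqP; split; apply: max_face_argmax_le => E _; rewrite topE.
have uniqG G : is_face Q G ->
    braid_cone F `<=` relative_interior (normal_cone Q G) -> G = max_face Q w.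
  move=> [w' ->] /(_ w wF); apply: relative_interior_normal_cone.
  by have [p /vertex_family_face pG] := vertex_family_ex w'; eexists; exact: pG.
by move=> G1 G2 [f1 c1] [f2 c2]; rewrite (uniqG G1) // (uniqG G2).
Qed.

Lemma affine_dim_face_of_flag F w : is_flag F -> braid_cone F w ->
  affine_dim (face_of_flag Q F) = splitting_rank H F.
Proof.
move=> fF wF; rewrite (face_of_flagE fF wF).
have [p pV] := vertex_family_ex w.
rewrite (affine_dimE (affine_hull_max_face pV)) dim_edge_space.
have H0 : finset.set0 \notin H.
  by apply/negP=> h0; have [i /argmax_setP[]] := argmax_edge w h0; rewrite inE.
rewrite /splitting_rank (splitting_argmax fF H0 ((braid_coneP _ fF).1 wF)).
by rewrite /hrank cardsT card_ord ncomponents_roots // argmax_hypergraph.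
Qed.

End Face.
End HypergraphicPolytope.

(** * Enumerators *)

Section Enumerator.
Variable n : nat.
Implicit Types (F : seq {set 'I_n}) (w : {ffun 'I_n -> nat}) (s : seq nat).

Lemma flag_of_pointE (R : realType) F (v : 'rV[R]_n) :
  is_flag F -> braid_cone F v -> flag_of_point v = F.
Proof.
move=> fF vF; apply: xget_subset1; first by split.
move=> F1 F2 [f1 v1] [f2 v2]; apply: flag_index_inj => // i j.
by rewrite -((braid_coneP _ f1).1 v1) -((braid_coneP _ f2).1 v2).
Qed.

Lemma level_flag_eq F w : is_flag F ->
  level_flag w = F <->
  forall i j, (w i <= w j)%N = (flag_index F i <= flag_index F j)%N.
Proof.
move=> fF; split=> [<- i j|wF]; first by rewrite level_flag_index.
apply: flag_index_inj (level_flagP _) fF _ => i j.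
by rewrite level_flag_index -wF.
Qed.

Lemma level_flag_braid (R : realType) w :
  braid_cone (level_flag w) (\row_i (w i)%:R : 'rV[R]_n).
Proof.
apply/(braid_coneP _ (level_flagP w)) => i j.
by rewrite !mxE ler_nat level_flag_index.
Qed.

Definition monomial_of_point w : {cmonom nat} :=
  \big[mmul/mone]_(i < n) ucm (w i).

Lemma monomial_of_point_neq0 w i : monomial_of_point w (w i) != 0%N.
Proof.
have -> : monomial_of_point w (w i) = (\sum_j (w j == w i))%N.
  rewrite (big_morph (fun m : {cmonom nat} => m (w i)) (cmM (w i)) (cm1 _)).
  by apply: eq_bigr => j _; rewrite cmU.
by rewrite (bigD1 i) //= eqxx.
Qed.

(** Every coordinate of the point is the index of a variable occurring in [m]. Finiteness matters
    because a sum with infinite support would default to 0. *)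
Lemma finite_monomial_of_point (m : {cmonom nat}) :
  finite_set [set w | monomial_of_point w = m].
Proof.
pose N := (\max_(v <- finsupp m) v).+1.
pose f (g : {ffun 'I_n -> 'I_N}) := [ffun i => val (g i)].
apply: (@sub_finite_set _ _ (f @` setT)); last first.
  exact: finite_image finite_finset.
move=> w /= wm; exists [ffun i => inord (w i)] => //.
apply/ffunP=> i; rewrite !ffunE /= inordK // ltnS.
apply: (@leq_bigmax_seq _ _ xpredT id) => //.
by rewrite -cmE_neq0 -wm monomial_of_point_neq0.
Qed.

Definition point_of_values F s : {ffun 'I_n -> nat} :=
  [ffun i => nth 0%N s (flag_index F i)].

Lemma monomial_point_of_values F s : is_flag F -> size s = size F ->
  monomial_of_point (point_of_values F s) = monomial_at (flag_type F) s.
Proof.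
move=> fF sF; have tF : size (flag_type F) = size F.
  by rewrite size_map size_pairmap.
rewrite /monomial_at (big_nth (0, 0)%N) size_zip sF tF minnn big_mkord.
rewrite /monomial_of_point.
(* Grouping the variables by blocks, block [a] contributes the variable indexed by [nth 0 s a] to
   the power of the block size. *)
rewrite (partition_big (fun i => Ordinal (flag_index_lt i fF)) xpredT) //=.
apply: eq_bigr => a _; rewrite nth_zip ?sF ?tF //=.
rewrite (nth_map finset.set0) ?size_pairmap // -/(flag_block F a).
rewrite flag_blockE //.
rewrite (eq_bigr (fun=> ucm (nth 0%N s a))); last first.
  by move=> i /eqP <-; rewrite ffunE.
rewrite big_const /expcmn -Monoid.iteropE; congr iterop.
by apply: eq_card => i; rewrite inE.
Qed.

Lemma point_of_values_le F s i j : is_flag F -> size s = size F ->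
  sorted ltn s -> (point_of_values F s i <= point_of_values F s j)%N =
    (flag_index F i <= flag_index F j)%N.
Proof.
move=> fF sF sS; rewrite !ffunE.
have lt k l : (flag_index F k < flag_index F l)%N ->
    (nth 0 s (flag_index F k) < nth 0 s (flag_index F l))%N.
  move=> kl; apply: (sorted_ltn_nth ltn_trans) => //;
    by rewrite inE sF flag_index_lt.
have [/lt/ltnW//|/lt|->] := ltngtP (flag_index F i) (flag_index F j).
  by rewrite ltnNge => /negbTE.
exact: leqnn.
Qed.

(** A point with flag [F] is constant on blocks and increases from block to block; the inverse map
    lists its values. *)
Lemma point_of_values_bij F (m : {cmonom nat}) : is_flag F ->
  set_bij
    ([set s | [/\ size s = size (flag_type F), sorted ltn s & all (leq 1) s]]
       `&` [set s | monomial_at (flag_type F) s = m])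
    ([set w : {ffun 'I_n -> nat} | forall i, (0 < w i)%N]
       `&` [set w | monomial_of_point w = m]
       `&` [set w : {ffun 'I_n -> nat} | level_flag w = F])
    (point_of_values F).
Proof.
move=> fF; have tF : size (flag_type F) = size F.
  by rewrite size_map size_pairmap.
rewrite tF; split.
- move=> s /= [[sF sS sP] sm]; split; first split.
  + move=> i; rewrite ffunE; have /all_nthP := sP; apply.
    by rewrite sF flag_index_lt.
  + by rewrite monomial_point_of_values.
  + by apply/level_flag_eq => // i j; rewrite point_of_values_le.
- move=> s1 s2; rewrite !inE /= => -[[s1F _ _] _] [[s2F _ _] _] /ffunP s12.
  apply: (@eq_from_nth _ 0%N) => [|a]; rewrite s1F ?s2F // => aF.
  have [i ia] := flag_index_surj fF aF.
  by have := s12 i; rewrite !ffunE ia.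
- move=> w /= [[w0 wm] /(level_flag_eq _ fF) wF].
  have wE i j : flag_index F i = flag_index F j -> w i = w j.
    by move=> ij; apply/eqP; rewrite eqn_leq !wF ij leqnn.
  (* The default 0 is never reached for [a < size F], since every block is nonempty. *)
  pose val_at a :=
    if [pick i | flag_index F i == a] is Some i then w i else 0%N.
  have val_atE i : val_at (flag_index F i) = w i.
    rewrite /val_at; case: pickP => [j /eqP/wE //|/(_ i)].
    by rewrite eqxx.
  have wS : point_of_values F (mkseq val_at (size F)) = w.
    by apply/ffunP=> i; rewrite ffunE nth_mkseq ?flag_index_lt.
  exists (mkseq val_at (size F)) => //; split; last first.
    by rewrite /= -monomial_point_of_values ?size_mkseq // wS.
  split; first by rewrite size_mkseq.
    apply/(sortedP 0%N) => a; rewrite size_mkseq => aF.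
    have [i ia] := flag_index_surj fF (ltnW aF).
    have [j ja] := flag_index_surj fF aF.
    rewrite !nth_mkseq // ?(ltnW aF) // -ja -ia !val_atE /= ltnNge wF.
    by rewrite ia ja ltnn.
  apply/(all_nthP 0%N) => a; rewrite size_mkseq => aF.
  have [i ia] := flag_index_surj fF aF.
  by rewrite nth_mkseq // -ia val_atE w0.
Qed.

(** A Kronecker delta for the sum over flags graded by length: only the length of [G] and the tuple
    [G] itself contribute. *)
Lemma sum_flags_eq (K : nmodType) G (f : seq {set 'I_n} -> K) : is_flag G ->
  \sum_(k < n.+1) \sum_(F : k.-tuple {set 'I_n} | is_flag F)
    (if G == F then f F else 0) = f G.
Proof.
move=> fG; have sG : (size G < n.+1)%N.
  by rewrite ltnS -[leqRHS]card_ord size_flag.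
rewrite (bigD1 (Ordinal sG)) //= (bigD1 (in_tuple G)) //= eqxx.
rewrite !big1 ?addr0 // => [k kG|F /andP[_ FG]].
  rewrite big1 // => F _; case: eqP => // GF; case/eqP: kG; apply: val_inj.
  by rewrite /= GF size_tuple.
by case: eqP => // GF; case/eqP: FG; apply: val_inj.
Qed.

End Enumerator.

Theorem theorem4p2 (R : realType) (K : comNzRingType) (q : K) (n : nat)
    (H : {set {set 'I_n}})
    (hypH : hypergraph [set: 'I_n] H) (connH : hconnected [set: 'I_n] H) :
  points_enumerator q (hypergraphic_polytope R H) = Psi q H.
Proof.
apply/funext=> m; rewrite /points_enumerator /Psi {1}/formal_sum.
set A := _ `&` _.
have finA : finite_set A.
  by apply: sub_finite_set (finite_monomial_of_point n m) => w [].
rewrite fsbig_finite //=.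
under eq_bigr => w _.
  rewrite (flag_of_pointE (level_flagP w) (@level_flag_braid n R w)).
  rewrite (affine_dim_face_of_flag hypH (level_flagP w)
             (@level_flag_braid n R w)).
  (* The weight of [w] becomes a sum over all flags supported at the flag of [w], so that the sums
     over points and flags can be exchanged. *)
  rewrite -(sum_flags_eq (fun F => q ^+ splitting_rank H F) (level_flagP w)).
  over.
rewrite exchange_big /=; apply: eq_bigr => k _.
rewrite exchange_big /=; apply: eq_bigr => F fF.
rewrite /monomial_qsym /formal_sum.
(* The coefficient of [m] in the monomial function of [F] counts the points with monomial [m] and
   flag [F]. *)
rewrite -(reindex_fsbig _ _ _ (fun=> 1) (point_of_values_bij m fF)).
rewrite fsbig_mkcondr fsbig_finite //= mulr_sumr; apply: eq_bigr => w _.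
by case: eqP => wF; [rewrite mem_set // mulr1|rewrite memNset // mulr0].
Qed.
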